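(* For every $n\ge 1$ and every even $k\ge 2$, every $n$-point path admits a shortcutting with hop-diameter $k$ and arboricity $O(\alpha_{k/2+1}(n))$.
   Context: A shortcutting of a tree $T=(V,E)$ with hop-diameter $k$ is a graph $G=(V,E')$, each edge $(x,y)$ having length $d_T(x,y)$ (the tree distance), such that for all $u,v\in V$ there is a $u$–$v$ path in $G$ with at most $k$ edges and length exactly $d_T(u,v)$. Arboricity of $G$: $\max_{H\subseteq G,|V(H)|\ge2}\lceil |E(H)|/(|V(H)|-1)\rceil$. Ackermann functions: $A(0,n)=2n$; for $k\ge1$, $A(k,0)=1$ and $A(k,n)=A(k-1,A(k,n-1))$ for $n\ge1$; $B(0,n)=n^2$; for $k\ge1$, $B(k,0)=2$ and $B(k,n)=B(k-1,B(k,n-1))$ for $n\ge1$. Inverse Ackermann: $\alpha_{2k}(n)=\min\{s\ge0: A(k,s)\ge n\}$ and $\alpha_{2k+1}(n)=\min\{s\ge0:B(k,s)\ge n\}$ (so $\alpha_2(n)=\lceil\log n\rceil$, $\alpha_3(n)=\lceil\log\log n\rceil$, $\alpha_4(n)=\log^* n$).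
   Formalization: The bound O(α_{k/2+1}(n)) is read as C·max(1, α_{k/2+1}(n)) with C absolute: for n = 2 and k/2+1 odd (e.g. k = 4) α_{k/2+1}(2) = 0, while any shortcutting of a 2-point path has arboricity 1; all other cases are unchanged. *)

(* Defs.v *)
From mathcomp Require Import all_boot all_order all_algebra.
From mathcomp Require Import classical_sets reals.
Set Implicit Arguments.
Unset Strict Implicit.
Unset Printing Implicit Defensive.
Import Order.TTheory GRing.Theory Num.Theory.

Record sgraph (V : finType) := SGraph {
  adj :> rel V;
  adj_sym : symmetric adj;
  adj_irrefl : irreflexive adj
}.

Definition edges (V : finType) (G : sgraph V) : {set {set V}} :=
  [set [set z.1; z.2] | z in [pred z : V * V | G z.1 z.2]].

(* A subgraph of G is a pair (vertex set, edge set); it need not be induced. *)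
Definition subgraph (V : finType) (H : {set V} * {set {set V}}) (G : sgraph V)
  : bool :=
  (H.2 \subset edges G) && [forall f in H.2, f \subset H.1].

Definition ceil_divn (m d : nat) : nat := (m + d.-1) %/ d.

Definition arboricity (V : finType) (G : sgraph V) : nat :=
  \max_(H : {set V} * {set {set V}} | subgraph H G && (2 <= #|H.1|))
     ceil_divn #|H.2| (#|H.1| - 1).

Definition path_graph (V : finType) (T : sgraph V) (n : nat) : Prop :=
  exists2 f : 'I_n -> V, bijective f
    & forall i j : 'I_n,
        T (f i) (f j) = (i.+1 == j :> nat) || (j.+1 == i :> nat).

Section Shortcutting.
Local Open Scope ring_scope.
Local Open Scope classical_set_scope.
Variables (R : realType) (V : finType).

(* Only the values of w on the edges of T matter; w = 1 is the unweighted
   tree T. *)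
Definition edge_weight (T : sgraph V) (w : V -> V -> R) : Prop :=
  (forall x y, w x y = w y x) /\ (forall x y, T x y -> 0 < w x y).

(* Length of the walk x :: p when a step from a to b has length l a b. *)
Definition walk_length (l : V -> V -> R) (x : V) (p : seq V) : R :=
  \sum_(a <- pairmap l x p) a.

(* Shortest-path distance. In a tree with positive weights the infimum is the
   length of the unique simple x-y path. *)
Definition tree_dist (T : sgraph V) (w : V -> V -> R) (x y : V) : R :=
  inf [set walk_length w x p | p in [set p | path T x p /\ last x p = y]].

Definition shortcutting (T : sgraph V) (w : V -> V -> R) (k : nat)
    (G : sgraph V) : Prop :=
  forall u v : V, exists p : seq V,
    [/\ path G u p, uniq (u :: p), last u p = v, (size p <= k)%N
      & walk_length (tree_dist T w) u p = tree_dist T w u v].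

End Shortcutting.

Fixpoint ackA (k : nat) : nat -> nat :=
  match k with
  | 0 => fun n => 2 * n
  | k'.+1 => fix ackAk n :=
      match n with 0 => 1 | n'.+1 => ackA k' (ackAk n') end
  end.

Fixpoint ackB (k : nat) : nat -> nat :=
  match k with
  | 0 => fun n => n ^ 2
  | k'.+1 => fix ackBk n :=
      match n with 0 => 2 | n'.+1 => ackB k' (ackBk n') end
  end.

Lemma ackA_gt k n : 0 < n -> n < ackA k n.
Proof.
elim: k n => [|k IHk] n n_gt0 /=; first by rewrite mul2n -addnn -ltn_subLR ?subnn.
suff H m : m < ackA k.+1 m by exact: (H n).
elim: m => [//|m IHm].
have h : 0 < ackA k.+1 m by exact: leq_ltn_trans IHm.
exact: (leq_ltn_trans IHm (IHk _ h)).
Qed.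

Lemma ackB_gt k n : 1 < n -> n < ackB k n.
Proof.
elim: k n => [|k IHk] n n_gt1 /=.
  by rewrite -mulnn ltn_Pmull // (ltn_trans _ n_gt1).
suff H m : m.+1 < ackB k.+1 m by exact: ltn_trans (H n).
elim: m => [//|m IHm].
have h : 1 < ackB k.+1 m by exact: leq_ltn_trans IHm.
exact: (leq_ltn_trans IHm (IHk _ h)).
Qed.

Lemma ackA_unbounded k n : exists s, n <= ackA k s.
Proof. by exists n.+1; rewrite ltnW // ltnW // ackA_gt. Qed.

Lemma ackB_unbounded k n : exists s, n <= ackB k s.
Proof. by exists n.+2; rewrite ltnW // ltnW // ltnW // ackB_gt. Qed.

Definition alpha (j n : nat) : nat :=
  if odd j then ex_minn (ackB_unbounded j./2 n)
  else ex_minn (ackA_unbounded j./2 n).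

(* Main.v *)
Require Import Defs.
From mathcomp Require Import all_boot all_order all_algebra.
From mathcomp Require Import classical_sets reals.
From mathcomp Require Import zify.
Set Implicit Arguments.
Unset Strict Implicit.
Unset Printing Implicit Defensive.

(** Work on the points 0, ..., n of a line and allow monotone hops only. An edge
    (p, q) may be charged to any gap a with p <= a < q, and the load is the
    number of edges charged to a gap. Cut the line into m blocks of b gaps, join
    each point to both ends of its block, join the cut points by a j-hop graph of
    load at most b, and recurse inside the blocks: since b gaps lie between
    consecutive cut points, the load b of a cut gap spreads to one edge per gap.
    So j + 2 hops cost O(1) per level of the recursion m b -> b, and the number of
    levels is alpha_{j+2}: j hops cost a load O(alpha_j).
    For small arboricity, edges are charged to an endpoint instead, i.e. oriented
    with bounded out-degree. Here each edge (p, q) of the j-hop graph on the cut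
    points is subdivided by the point it is charged to, which becomes the tail of
    both halves. This turns j hops into 2 j and the same recursion gives 2 j + 2
    hops with out-degree O(alpha_{j+2}).
    Sizes are kept of the form 4 A(s) + 21 for a load 4 s + 21: the factor b gained
    by cutting into blocks absorbs the constants, so that these do not grow
    with the number of hops. *)

(** * Monotone hops on a line *)

Fixpoint hop (E : nat -> nat -> Prop) (k u v : nat) : Prop :=
  if k is k'.+1 then
    exists2 x, u <= x <= v & (u = x \/ E u x) /\ hop E k' x v
  else u = v.

Lemma hop_le E k u v : hop E k u v -> u <= v.
Proof. by case: k => [->//|k [x /andP[ux xv] _]]; apply: leq_trans xv. Qed.

Lemma hop_refl E k u : hop E k u u.
Proof. by elim: k => //= k IH; exists u; [rewrite leqnn | split; [left|]]. Qed.

Lemma hop_edge (E : nat -> nat -> Prop) u v : u <= v -> E u v -> hop E 1 u v.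
Proof. by move=> uv Euv; exists v; [rewrite uv leqnn | split; [right|]]. Qed.

Lemma hop_cat E j k u x v : hop E j u x -> hop E k x v -> hop E (j + k) u v.
Proof.
move=> + xv; elim: j u => [|j IH] u /=; first by move->.
case=> y /andP[uy yx] [Euy hyx]; exists y; last by split=> //; exact: IH.
by rewrite uy (leq_trans yx (hop_le xv)).
Qed.

Lemma hop_map (f : nat -> nat) E E' j k u v :
  (forall p q, p <= q -> E p q -> hop E' j (f p) (f q)) ->
  hop E k u v -> hop E' (j * k) (f u) (f v).
Proof.
move=> EE'; elim: k u => [|k IH] u /=; first by move=> ->; rewrite muln0.
case=> x /andP[ux xv] [Eux hxv]; rewrite mulnS; apply: hop_cat (IH _ hxv).
by case: Eux => [->|Eux]; [exact: hop_refl | exact: EE'].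
Qed.

(** A step of [hop] may stay in place, so [k] is only an upper bound and idle steps pad the end. *)
Lemma hop_sub (E E' : nat -> nat -> Prop) k k' u v :
  (forall p q, E p q -> E' p q) -> k <= k' -> hop E k u v -> hop E' k' u v.
Proof.
move=> EE' kk' h; rewrite -(subnKC kk'); apply: hop_cat (hop_refl _ _ _).
rewrite -[k]mul1n; apply: (hop_map (f := id)) h => p q pq Epq.
by apply: hop_edge => //; exact: EE'.
Qed.

(** * Spanners of bounded load and their recursion over blocks *)

Definition owned (n : nat) (ld : nat -> seq (nat * nat)) (p q : nat) : Prop :=
  exists2 a, a < n & (p, q) \in ld a.

(** [P] decides what indexes the load: a gap for [across], an endpoint for [incident], where [l]
    bounds an out-degree. Loaded pairs may reach beyond [n]. *)
Definition spanner (P : nat -> nat -> nat -> Prop) (k n l : nat) : Prop :=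
  exists ld : nat -> seq (nat * nat),
    [/\ forall a, size (ld a) <= l,
        forall a p q, (p, q) \in ld a -> P a p q
      & forall u v, u <= v -> v <= n -> hop (owned n ld) k u v].

Definition across (a p q : nat) : Prop := p <= a < q.
Definition incident (a p q : nat) : Prop := p = a \/ q = a.

Lemma spannerW P k k' n l l' :
  k <= k' -> l <= l' -> spanner P k n l -> spanner P k' n l'.
Proof.
move=> kk' ll' [ld [sz own sp]]; exists ld; split=> //.
  by move=> a; apply: leq_trans ll'.
by move=> u v uv vn; apply: (hop_sub _ kk' (sp _ _ uv vn)).
Qed.

(** The part common to both ways of charging: leaving the block of [u] and entering that of [v] cost
    one hop each, around [k] hops between inner cut points. *)
Lemma spanner_blocks P k m b e l (ext : nat -> seq (nat * nat)) :
  0 < b -> (forall s a p q, P a p q -> P (s + a) (s + p) (s + q)) ->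
  spanner P k.+2 b l ->
  (forall a, size (ext a) <= e) ->
  (forall a p q, (p, q) \in ext a -> P a p q) ->
  (forall i u, i < m -> i * b <= u -> u <= i.+1 * b ->
     hop (owned (m * b) ext) 1 u (i.+1 * b) /\
     hop (owned (m * b) ext) 1 (i * b) u) ->
  (forall i j, 0 < i -> i <= j -> j < m ->
     hop (owned (m * b) ext) k (i * b) (j * b)) ->
  spanner P k.+2 (m * b) (e + l).
Proof.
move=> b_gt0 Pshift [ld [sz own sp]] szx ownx endx cutx.
pose ld' a := ext a ++
  [seq (a %/ b * b + z.1, a %/ b * b + z.2) | z <- ld (a %% b)].
have sub k' k'' u v : k' <= k'' ->
    hop (owned (m * b) ext) k' u v -> hop (owned (m * b) ld') k'' u v.
  by apply: hop_sub => p q [a am pq]; exists a => //; rewrite mem_cat pq.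
exists ld'; split=> [a|a p q|u v uv vn].
- by rewrite size_cat size_map leq_add.
- rewrite mem_cat => /orP[/ownx//|/mapP[[p' q'] /= pq [-> ->]]].
  by rewrite {1}(divn_eq a b); apply/Pshift/own.
have [->|u_neq] := eqVneq u v; first exact: hop_refl.
have {uv u_neq} uv : u < v by rewrite ltn_neqAle u_neq.
have dnn x : x %/ b * b <= x by rewrite leq_divM.
have dnl x : x < (x %/ b).+1 * b by rewrite -ltn_divLR.
(* With [v.-1], a cut point [v] counts as the right end of the block before it; in particular
   [j < m] when [v = m * b]. *)
set i := u %/ b; set j := v.-1 %/ b.
have vv : v = v.-1.+1 by rewrite prednK //; apply: leq_ltn_trans uv.
have ij : i <= j by rewrite leq_div2r // -ltnS -vv.
have jm : j < m by rewrite ltn_divLR // -vv.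
have jv : j * b <= v by apply: leq_trans (dnn _) (leq_pred _).
have vj : v <= j.+1 * b by rewrite vv; exact: dnl.
move: ij; rewrite leq_eqVlt => /orP[/eqP ij|ij].
  have iu : i * b <= u by exact: dnn.
  rewrite -(subnKC iu) -[v](subnKC (n := v) (m := i * b)); last by lia.
  rewrite -[k.+2]mul1n; apply: (hop_map (f := addn (i * b))); last first.
    by apply: (sp (u - i * b) (v - i * b)); nia.
  move=> p q pq [a ab apq]; apply: hop_edge; first by lia.
  exists (i * b + a); first by nia.
  rewrite mem_cat; apply/orP; right; apply/mapP.
  rewrite divnMDl // (divn_small ab) addn0 modnMDl (modn_small ab).
  by exists (p, q).
have [h1 _] := endx i u (ltn_trans ij jm) (dnn _) (ltnW (dnl _)).
have [_ h2] := endx j v jm jv vj.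
have h := hop_cat h1 (hop_cat (cutx i.+1 j isT ij jm) h2).
by apply: sub h; rewrite add1n addn1.
Qed.

(* The gaps of block [i] carry, one pair each, the pairs loaded on the gap
   between the cut points [i * b] and [i.+1 * b]. *)
Lemma spread_load j m b :
  0 < b -> spanner across j m b ->
  exists ld : nat -> seq (nat * nat),
    [/\ forall a, size (ld a) <= 1,
        forall a p q, (p, q) \in ld a -> p <= a < q
      & forall u v, 0 < u -> u <= v -> v < m.+2 ->
          hop (owned (m.+2 * b) ld) j (u * b) (v * b)].
Proof.
move=> b_gt0 [ld [sz own sp]].
(* Only the [m.+1] inner cut points are joined: gap [g] between them is block [g.+1], and the first
   block carries nothing. *)
pose ld' a := if a < b then [::] else
  take 1 (drop (a %% b) [seq (z.1.+1 * b, z.2.+1 * b) | z <- ld (a %/ b).-1]).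
exists ld'; split=> [a|a p q|].
- by rewrite /ld'; case: ifP => // _; rewrite size_take_min geq_minl.
- rewrite /ld'; case: ltnP => // ba /mem_take/mem_drop/mapP[[p' q'] /own /=].
  case/andP=> p'a aq' [-> ->].
  have d_gt0 : 0 < a %/ b by rewrite divn_gt0.
  rewrite -leq_divRL // -ltn_divLR //; lia.
case=> // u [//|v] _ uv vm.
rewrite -[j]mul1n; apply: (hop_map (f := fun x => x.+1 * b)); last first.
  exact: (sp u v).
move=> p q pq [g gm gpq]; apply: hop_edge; first by rewrite leq_mul2r ltnS pq orbT.
have rb : index (p, q) (ld g) < b.
  by apply: leq_trans (sz g); rewrite index_mem.
exists (g.+1 * b + index (p, q) (ld g)); first by nia.
rewrite /ld' ifN; last by rewrite -leqNgt; nia.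
rewrite divnMDl // modnMDl divn_small // modn_small // addn0 /=.
rewrite -map_drop -map_take.
rewrite (drop_nth (p, q)) ?index_mem //= take0 nth_index //=.
by rewrite inE.
Qed.

(** For the left end, [u] is charged to gap [u.-1], for the right end to gap [u]. With the spread
    pair this makes three; 4 is the increment shared with [incident_step]. *)
Lemma across_step j m b l :
  0 < b -> spanner across j.+2 b l -> spanner across j m b ->
  spanner across j.+2 (m.+2 * b) (4 + l).
Proof.
move=> b_gt0 spb /(spread_load b_gt0)[ld [sz own cut]].
have dnn x : x %/ b * b <= x by rewrite leq_divM.
have dnl x : x < (x %/ b).+1 * b by rewrite -ltn_divLR.
pose ext a := [:: (a %/ b * b, a.+1); (a, (a %/ b).+1 * b)] ++ ld a.
apply: (spanner_blocks (ext := ext)) => //.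
- by move=> s a p q; rewrite /across; lia.
- by move=> a; rewrite /= ltnS ltnS; apply: leq_trans (sz a) _.
- move=> a p q; rewrite mem_cat => /orP[|/own//].
  rewrite /across !inE => /orP[]/eqP[-> ->].
    by rewrite dnn leqnn.
  by rewrite leqnn dnl.
- move=> i u im iu ui; split.
    have [->|u_neq] := eqVneq u (i.+1 * b); first exact: hop_refl.
    apply: hop_edge => //; exists u; first by nia.
    suff -> : (u, i.+1 * b) = (u, (u %/ b).+1 * b).
      by rewrite mem_cat !inE eqxx orbT.
    suff -> : u %/ b = i by [].
    by apply/eqP; rewrite eqn_leq -ltnS ltn_divLR // leq_divRL //; lia.
  have [->|u_neq] := eqVneq u (i * b); first exact: hop_refl.
  apply: hop_edge => //; exists u.-1; first by nia.
  suff -> : (i * b, u) = (u.-1 %/ b * b, u.-1.+1) by rewrite mem_cat !inE eqxx.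
  have ui' : u.-1 %/ b = i.
    by apply/eqP; rewrite eqn_leq -ltnS ltn_divLR // leq_divRL //; lia.
  by rewrite ui' prednK //; lia.
move=> i i' i0 ii' im; apply: hop_sub (cut _ _ i0 ii' im) => // p q [a am pq].
by exists a => //; rewrite mem_cat pq orbT.
Qed.

(** The 4 counts two block ends and the two halves of at most one subdivided pair. *)
Lemma incident_step j m b l :
  0 < b -> spanner incident (2 * j).+2 b l -> spanner across j m b ->
  spanner incident (2 * j).+2 (m.+2 * b) (4 + l).
Proof.
move=> b_gt0 spb /(spread_load b_gt0)[ld [sz own cut]].
have dnn x : x %/ b * b <= x by rewrite leq_divM.
have dnl x : x < (x %/ b).+1 * b by rewrite -ltn_divLR.
pose ext a := [:: (a %/ b * b, a); (a, (a %/ b).+1 * b)] ++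
  flatten [seq [:: (z.1, a); (a, z.2)] | z <- ld a].
apply: (spanner_blocks (ext := ext)) => //.
- by rewrite /incident => s a p q [] ->; [left|right].
- by move=> a; rewrite /= !ltnS; case: (ld a) (sz a) => [|z []].
- move=> a p q; rewrite mem_cat /incident => /orP[|/flatten_mapP[z _]];
  by rewrite !inE => /orP[]/eqP[-> ->]; [right|left].
- have divi i u : i * b <= u -> u < i.+1 * b -> u %/ b = i.
    by move=> iu ui; apply/eqP; rewrite eqn_leq -ltnS ltn_divLR // leq_divRL // ui.
  have to_right i u : i < m.+2 -> i * b <= u -> u <= i.+1 * b ->
      hop (owned (m.+2 * b) ext) 1 u (i.+1 * b).
    move=> im iu ui.
    have [->|u_neq] := eqVneq u (i.+1 * b); first exact: hop_refl.
    have {ui u_neq} ui : u < i.+1 * b by rewrite ltn_neqAle u_neq.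
    apply: hop_edge; first exact: ltnW.
    by exists u; [nia | rewrite mem_cat !inE (divi i) // eqxx orbT].
  move=> i u im iu ui; split; first exact: to_right.
  (* Division puts the right end in the next block, so the pair of both ends is taken from the list
     of the left end. *)
  have [->|u_neq] := eqVneq u (i.+1 * b).
    by apply: to_right => //; rewrite leq_mul2r leqnSn orbT.
  have {ui u_neq} ui : u < i.+1 * b by rewrite ltn_neqAle u_neq.
  apply: hop_edge => //.
  by exists u; [nia | rewrite mem_cat !inE (divi i) // eqxx].
move=> i i' i0 ii' im; apply: (hop_map (f := id)) (cut _ _ i0 ii' im).
move=> p q pq [a am apq]; have /andP[pa aq] := own _ _ _ apq.
apply: (@hop_cat _ 1 1 _ a); apply: hop_edge => //; try exact: ltnW.
  exists a => //; rewrite mem_cat; apply/orP; right.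
  by apply/flatten_mapP; exists (p, q); rewrite // !inE eqxx.
exists a => //; rewrite mem_cat; apply/orP; right.
by apply/flatten_mapP; exists (p, q); rewrite // !inE eqxx orbT.
Qed.

(** * Sizes reached with a given load *)

Definition ack (j s : nat) : nat := if odd j then ackB j./2 s else ackA j./2 s.

Lemma ackSS j s : ack j.+2 s.+1 = ack j (ack j.+2 s).
Proof. by rewrite /ack /= negbK; case: (odd j). Qed.

Lemma ack0_le j : ack j.+2 0 <= 2.
Proof. by rewrite /ack /= negbK; case: (odd j). Qed.

(* The offset 21 absorbs the levels at which the path is too short for the
   recursion: [2 ^ 5] gaps are handled by halving, with load [1 + 4 * 5]. *)
Definition cap (j s : nat) : nat := 4 * ack j s + 21.

Lemma spanner_two P :
  P 0 0 1 -> (forall s a p q, P a p q -> P (s + a) (s + p) (s + q)) ->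
  (forall b l, 0 < b -> spanner P 2 b l -> spanner P 2 (2 * b) (4 + l)) ->
  spanner P 2 32 21.
Proof.
move=> P1 Pshift double.
apply: (double 16 17) => //; apply: (double 8 13) => //.
apply: (double 4 9) => //; apply: (double 2 5) => //.
apply: (double 1 1) => //; exists (fun a => [:: (a, a.+1)]); split=> //.
  move=> a p q; rewrite inE => /eqP[-> ->].
  by have := Pshift a _ _ _ P1; rewrite addn0 addn1.
move=> [|[|u]] [|[|v]] // _ _; try exact: hop_refl.
apply: (@hop_cat _ 1 1 _ 1); last exact: hop_refl.
by apply: hop_edge => //; exists 0.
Qed.

(** At level [s] the block size [b] is at least [4 * t + 21] for [t = ack j.+2 s]. So [core]
    applies, and [cap j t] is [cap j.+2 s.+1]. *)
Lemma spanner_levels P k j :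
  (forall m b l, 0 < b -> spanner P k b l -> spanner across j m b ->
     spanner P k (m.+2 * b) (4 + l)) ->
  (forall t b, 4 * t + 21 <= b ->
     exists m, spanner across j m b /\ cap j t <= m.+2 * b) ->
  spanner P k 32 21 ->
  forall s, exists n, spanner P k n (4 * s + 21) /\ cap j.+2 s <= n.
Proof.
move=> step core base; elim=> [|s [b [spb capb]]].
  by exists 32; split=> //; rewrite /cap; have := ack0_le j; lia.
have b_gt0 : 0 < b by rewrite /cap in capb; lia.
have [m [spm capm]] := core _ _ capb.
exists (m.+2 * b); split; last by rewrite /cap ackSS.
by have := step _ _ _ b_gt0 spb spm; rewrite mulnS addnA.
Qed.

Lemma across_hop0 b : spanner across 0 0 b.
Proof. by exists (fun=> [::]); split=> // u v /=; lia. Qed.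

(** The complete graph, each pair charged to the gap just after its left point. *)
Lemma across_hop1 b : spanner across 1 b b.
Proof.
exists (fun a => [seq (a, q) | q <- iota a.+1 b]); split=> [a|a p q|u v uv vb].
- by rewrite size_map size_iota.
- by case/mapP=> x; rewrite mem_iota /across => ? [-> ->]; lia.
have [->|u_neq] := eqVneq u v; first exact: hop_refl.
apply: hop_edge => //; exists u; first by lia.
by apply/mapP; exists v; rewrite // mem_iota; lia.
Qed.

Lemma across_two : spanner across 2 32 21.
Proof.
apply: spanner_two => // [s a p q|b l b_gt0 sp]; first by rewrite /across; lia.
exact: across_step (across_hop0 b).
Qed.

Lemma incident_two : spanner incident 2 32 21.
Proof.
apply: spanner_two => [|s a p q []->|b l b_gt0 sp]; [by left|by left|by right|].
exact: incident_step (across_hop0 b).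
Qed.

(** Two blocks without cut edges double [b], the complete graph squares it: these match [ackA 0] and
    [ackB 0]. Larger [j] follow by levels over [j - 2]. *)
Lemma across_core j t b :
  4 * t + 21 <= b -> exists m, spanner across j m b /\ cap j t <= m.+2 * b.
Proof.
have [n] := ubnP j; elim: n j t b => // n IH [|[|j]] t b jn tb.
- by exists 0; split; [exact: across_hop0 | rewrite /cap /ack /=; lia].
- by exists b; split; [exact: across_hop1 | rewrite /cap /ack /=; nia].
have [|||m [spm capm]] := @spanner_levels across j.+2 j _ _ _ t.
- by move=> m c l; exact: across_step.
- by move=> t' c; apply: IH; lia.
- exact: spannerW across_two.
exists m; split; first exact: spannerW spm.
by apply: leq_trans capm _; nia.
Qed.

Lemma incident_spanner j s :
  exists n, spanner incident (2 * j).+2 n (4 * s + 21) /\ ack j.+2 s <= n.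
Proof.
have [|||n [sp capn]] := @spanner_levels incident (2 * j).+2 j _ _ _ s.
- by move=> m b l; exact: incident_step.
- exact: across_core.
- exact: spannerW incident_two.
by exists n; split=> //; apply: leq_trans capn; rewrite /cap; lia.
Qed.

Lemma alpha_ack j n : n <= ack j (alpha j n).
Proof. by rewrite /ack /alpha; case: (odd j); case: ex_minnP. Qed.

(** * Walks obtained from hops *)

Lemma path_rev (T : Type) (r : rel T) x p :
  path r x p -> exists p',
    [/\ path (fun a b => r b a) (last x p) p', last (last x p) p' = x
      & size p' = size p].
Proof.
move=> xp; exists (rev (belast x p)); split; first by rewrite rev_path.
  by case: p xp => //= y p _; rewrite rev_cons last_rcons.
by rewrite size_rev size_belast.
Qed.

Lemma hop_path (V : Type) (f : nat -> V) (n : nat) (E : nat -> nat -> Prop)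
    (r : rel V) k u v :
  (forall p q, p < q -> q <= n -> E p q -> r (f p) (f q)) ->
  v <= n -> hop E k u v ->
  exists p, [/\ path r (f u) p, last (f u) p = f v & size p <= k].
Proof.
move=> Er vn; elim: k u => [|k IH] u /=; first by move=> ->; exists [::].
case=> x /andP[ux xv] [Eux /IH[p [rp lp sp]]].
have [->|u_neq] := eqVneq u x; first by exists p; split=> //; exact: leqW.
exists (f x :: p); split=> //=; rewrite rp andbT Er //.
- by rewrite ltn_neqAle u_neq.
- exact: leq_trans vn.
by case: Eux u_neq => // ->; rewrite eqxx.
Qed.

(** * Arboricity from bounded out-degree *)

Section Orientation.
Variables (V : finType) (out : V -> seq {set V}).

Definition oriented_adj : rel V :=
  fun x y => (x != y) && ([set x; y] \in out x ++ out y).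

Lemma oriented_adj_sym : symmetric oriented_adj.
Proof.
by move=> x y; rewrite /oriented_adj eq_sym finset.setUC !mem_cat orbC.
Qed.

Lemma oriented_adj_irrefl : irreflexive oriented_adj.
Proof. by move=> x; rewrite /oriented_adj eqxx. Qed.

Definition oriented_graph := SGraph oriented_adj_sym oriented_adj_irrefl.

(** Each edge of a subgraph is listed at one of its endpoints, so there are at most [d * #|A|] of
    them, and [#|A| <= 2 * (#|A| - 1)]. *)
Lemma arboricity_oriented d :
  (forall x, size (out x) <= d) -> arboricity oriented_graph <= 2 * d.
Proof.
move=> outd; apply/bigmax_leqP => -[A F] /= /andP[/andP[/= Fe /forall_inP FA]].
move=> A_gt1; rewrite /ceil_divn -ltnS ltn_divLR ?subn_gt0 //.
have FU : F \subset \bigcup_(x in A) [set e in out x].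
  apply/fintype.subsetP => e eF; have /imsetP[[x y]] := fintype.subsetP Fe _ eF.
  rewrite inE /= => /andP[_ xy] De; have := FA _ eF; rewrite De finset.subUset !finset.sub1set.
  case/andP=> xA yA; apply/finset.bigcupP; move: xy; rewrite mem_cat => /orP[] xy.
    by exists x; rewrite // inE.
  by exists y; rewrite // inE.
have FdA : #|F| <= #|A| * d.
  apply: leq_trans (subset_leq_card FU) _; rewrite -sum_nat_const.
  apply: (big_ind2 (fun (B : {set {set V}}) n => #|B| <= n)) => [|B m C n Bm Cn|x _].
  - by rewrite cards0.
  - by rewrite cardsU; apply: leq_trans (leq_subr _ _) (leq_add Bm Cn).
  by apply: leq_trans (outd x); rewrite cardsE card_size.
move: A_gt1 FdA; case: #|A| => [|[|a]] // _; rewrite subn1 /=; move: #|F| => f; nia.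
Qed.

End Orientation.

(** * Distances from potentials *)

Section Potential.
Import Order.TTheory GRing.Theory Num.Theory.
Local Open Scope ring_scope.
Variables (R : realType) (V : finType).
Implicit Types (l : V -> V -> R) (phi : V -> R) (r : rel V).

Lemma walk_length_cons l x y p :
  walk_length l x (y :: p) = l x y + walk_length l y p.
Proof. by rewrite /walk_length /= big_cons. Qed.

Lemma walk_length_ge l phi r x p :
  (forall a b, r a b -> phi b - phi a <= l a b) -> path r x p ->
  phi (last x p) - phi x <= walk_length l x p.
Proof.
move=> lphi; elim: p x => [|y p IH] x /=; first by rewrite /walk_length big_nil subrr.
case/andP=> xy yp; rewrite walk_length_cons.
by have := lerD (lphi _ _ xy) (IH y yp); rewrite addrC addrA subrK.
Qed.

Lemma walk_length_eq l phi r x p :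
  (forall a b, r a b -> l a b = phi b - phi a) -> path r x p ->
  walk_length l x p = phi (last x p) - phi x.
Proof.
move=> lphi; elim: p x => [|y p IH] x /=; first by rewrite /walk_length big_nil subrr.
case/andP=> xy yp; rewrite walk_length_cons lphi // IH //.
by rewrite addrC addrA subrK.
Qed.

(** The growth of [phi] bounds every walk from below, and the walk [p] attains the bound. *)
Lemma tree_dist_potential (T : sgraph V) w phi r x p :
  (forall a b, T a b -> phi b - phi a <= w a b) ->
  (forall a b, r a b -> T a b /\ w a b = phi b - phi a) ->
  path r x p -> tree_dist T w x (last x p) = phi (last x p) - phi x.
Proof.
move=> wphi rphi xp; rewrite /tree_dist; set S := (X in inf X).
have Sp : S (phi (last x p) - phi x).
  exists p; last by apply: walk_length_eq xp => a b /rphi[].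
  by split=> //; apply: sub_path xp => a b /rphi[].
have Slb : lbound S (phi (last x p) - phi x).
  by move=> _ [q [xq <-] <-]; exact: walk_length_ge xq.
apply/eqP; rewrite eq_le ge_inf //=; last by exists (phi (last x p) - phi x).
by apply: lb_le_inf => //; exists (phi (last x p) - phi x).
Qed.

End Potential.

(** * The weighted path as points on a line *)

Section PathMetric.
Import Order.TTheory GRing.Theory Num.Theory.
Local Open Scope ring_scope.
Variables (R : realType) (V : finType) (T : sgraph V) (w : V -> V -> R).
Variables (n : nat) (f : 'I_n.+1 -> V) (g : V -> 'I_n.+1).
Hypotheses (fK : cancel f g) (gK : cancel g f).
Hypothesis Tf : forall i j : 'I_n.+1,
  T (f i) (f j) = (i.+1 == j :> nat) || (j.+1 == i :> nat).
Hypothesis w_weight : edge_weight T w.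

Definition position (x : V) : nat := g x.
Definition vertex (t : nat) : V := f (inord t).

Lemma position_le x : (position x <= n)%N.
Proof. by rewrite -ltnS; exact: ltn_ord. Qed.

Lemma vertexK t : (t <= n)%N -> position (vertex t) = t.
Proof. by move=> tn; rewrite /position /vertex fK inordK. Qed.

Lemma positionK x : vertex (position x) = x.
Proof. by rewrite /position /vertex inord_val gK. Qed.

Definition coordinate (x : V) : R :=
  \sum_(0 <= t < position x) w (vertex t) (vertex t.+1).

Definition next_to : rel V := fun x y => position y == (position x).+1.

Lemma next_toP x y :
  next_to x y -> T x y /\ w x y = coordinate y - coordinate x.
Proof.
move=> /eqP xy; split.
  by rewrite -[x]gK -[y]gK Tf; apply/orP; left; rewrite -/(position y) xy.
rewrite /coordinate xy big_nat_recr //= -xy !positionK.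
by rewrite [RHS]addrC addrA addNr add0r.
Qed.

Lemma adjP x y : T x y = next_to x y || next_to y x.
Proof. by rewrite -[x in T x]gK -[y in T _ y]gK Tf ![_.+1 == _]eq_sym. Qed.

Lemma coordinate_lip x y :
  T x y -> `|coordinate y - coordinate x| <= w x y.
Proof.
have [wC w_gt0] := w_weight.
by rewrite adjP => /orP[]/next_toP[/w_gt0 w0 wE]; last rewrite distrC wC;
  rewrite -wE gtr0_norm.
Qed.

Lemma next_to_path x y :
  (position x <= position y)%N -> exists2 p, path next_to x p & last x p = y.
Proof.
move=> /subnKC; move: (position y - position x)%N => d.
elim: d x => [|d IH] x xy.
  by exists [::]; rewrite //= -[x]positionK -[y]positionK -xy addn0.
have xn : ((position x).+1 <= n)%N.
  by apply: leq_trans (position_le y); rewrite -xy -addSnnS leq_addr.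
have [|p xp yp] := IH (vertex (position x).+1); first by rewrite vertexK // addSnnS.
by exists (vertex (position x).+1 :: p); rewrite //= xp andbT /next_to vertexK.
Qed.

Lemma tree_dist_le x y : (position x <= position y)%N ->
  tree_dist T w x y = coordinate y - coordinate x.
Proof.
case/next_to_path=> p xp <-; apply: tree_dist_potential xp => [a b|].
  by move/coordinate_lip; apply: le_trans; exact: ler_norm.
exact: next_toP.
Qed.

Lemma tree_dist_ge x y : (position y <= position x)%N ->
  tree_dist T w x y = coordinate x - coordinate y.
Proof.
have [wC _] := w_weight.
move=> /next_to_path[p yp xp]; have [q [xq yq _]] := path_rev yp.
rewrite xp in xq yq; rewrite -yq.
rewrite -[X in X - _]opprK addrC.
(* Walking down the line, the negated coordinate is the potential that grows. *)
apply: (@tree_dist_potential _ _ _ _ (fun z => - coordinate z)) xq => a b.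
  move/coordinate_lip; apply: le_trans; rewrite opprK addrC distrC.
  by rewrite addrC ler_norm.
by case/next_toP=> Tba wba; rewrite adj_sym wC opprK addrC.
Qed.

Lemma shortcutting_oriented k N d (ld : nat -> seq (nat * nat)) :
  (n < N)%N ->
  (forall a, (size (ld a) <= d)%N) ->
  (forall a p q, (p, q) \in ld a -> incident a p q) ->
  (forall u v, (u <= v)%N -> (v <= N)%N -> hop (owned N ld) k u v) ->
  exists G : sgraph V, shortcutting T w k G /\ (arboricity G <= 2 * d)%N.
Proof.
move=> nN sz own sp.
(* Points beyond [n] fall back to position 0 through [inord]; such pairs can only add edges already
   counted in [out]. *)
pose out x := [seq [set vertex z.1; vertex z.2]%SET | z <- ld (position x)].
exists (oriented_graph out); split; last first.
  by apply: arboricity_oriented => x; rewrite size_map.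
(* Increasing positions make [up] walks simple and their lengths telescope; for [v] before [u] the
   walk is reversed. *)
pose up : rel V := fun x y => (position x < position y)%N && oriented_graph out x y.
have up_path x y : (position x <= position y)%N ->
    exists p, [/\ path up x p, last x p = y & (size p <= k)%N].
  move=> xy; rewrite -[x]positionK -[y]positionK.
  have yN : (position y <= N)%N := leq_trans (position_le y) (ltnW nN).
  apply: hop_path (position_le y) (sp _ _ xy yN) => p q pq qn [a _ apq].
  have pn := leq_trans (ltnW pq) qn.
  rewrite /up !vertexK // pq /= /oriented_adj; apply/andP; split.
    by apply: contraTneq pq => /(congr1 position); rewrite !vertexK // => ->; rewrite ltnn.
  have e : [set vertex p; vertex q]%SET \in out (vertex a).
    apply/mapP; exists (p, q) => //; rewrite vertexK //.
    by case: (own _ _ _ apq) => <-.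
  by rewrite mem_cat; case: (own _ _ _ apq) => ae; rewrite -ae in e; rewrite e ?orbT.
move=> u v; case/orP: (leq_total (position u) (position v)) => uv.
  have [p [pp lp kp]] := up_path _ _ uv; exists p; split=> //.
  - by apply: sub_path pp => a b /andP[].
  - apply: (@map_uniq _ _ position); apply: (sorted_uniq ltn_trans ltnn).
    by rewrite /= path_map; apply: sub_path pp => a b /andP[].
  rewrite tree_dist_le // -lp; apply: walk_length_eq pp => a b /andP[ab _].
  exact/tree_dist_le/ltnW.
have [q [qq lq kq]] := up_path _ _ uv; have [p [pp lp kp]] := path_rev qq.
rewrite lq in pp lp; exists p; split=> //; last 2 first.
- by rewrite kp.
- rewrite tree_dist_ge // -lp addrC -[X in _ + X]opprK.
  apply: (@walk_length_eq _ _ _ (fun z => - coordinate z)) pp => a b /andP[ab _].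
  by rewrite opprK addrC; exact/tree_dist_ge/ltnW.
- by apply: sub_path pp => a b /andP[_]; rewrite (adj_sym (oriented_graph out)).
apply: (@map_uniq _ _ position); apply: (@sorted_uniq _ (fun a b => (b < a)%N)).
- by move=> y x z xy yz; exact: ltn_trans yz xy.
- exact: ltnn.
by rewrite /= path_map; apply: sub_path pp => a b /andP[].
Qed.

End PathMetric.

(* alpha 3, alpha 5, ... vanish at n = 2, where a shortcutting must contain the
   edge joining the two points and so has arboricity 1; O(alpha) is therefore
   read as O(max(1, alpha)), with a constant independent of n and k. *)
Theorem theorem1p4 :
  exists C : nat,
    forall (n k : nat) (R : realType) (V : finType) (T : sgraph V)
           (w : V -> V -> R),
      1 <= n -> 2 <= k -> ~~ odd k ->
      path_graph T n -> edge_weight T w ->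
      exists G : sgraph V,
        shortcutting T w k G /\
        arboricity G <= C * maxn 1 (alpha (k %/ 2 + 1) n).
Proof.
(* Out-degree [4 * a + 21] gives arboricity at most [8 * a + 42 <= 50 * maxn 1 a]. *)
exists 50 => -[//|n] k R V T w _ k_ge2 k_even [f [g fK gK] Tf] w_weight.
pose j := k./2.-1.
have kE : k = (2 * j).+2 by rewrite /j; lia.
have -> : k %/ 2 + 1 = j.+2 by lia.
have [N [[ld [sz own sp]] aN]] := incident_spanner j (alpha j.+2 n.+1).
have nN : n < N := leq_trans (alpha_ack _ _) aN.
rewrite -kE in sp.
have [G [Gsc Ga]] := shortcutting_oriented fK gK Tf w_weight nN sz own sp.
by exists G; split=> //; apply: leq_trans Ga _; lia.
Qed.
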